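(* For all integers $d\ge0$ and $\alpha,\beta\ge0$, $$c^d_{\alpha,\beta}=\sum_{u+v=\alpha+\beta}b^d_{u,v}\,\varepsilon(\alpha,\beta;u,v),$$ where the sum is over non-negative integers $u,v$ with $u+v=\alpha+\beta$.
   Context: Conventions: $\binom nk=0$ unless $0\le k\le n$, and $0^0=1$. $c^d_{\alpha,\beta}=\sum_{k\in\mathbb{Z}}\binom{\alpha+\beta}{k}(\beta-k)^d(-1)^k$. The integers $b^d_{u,v}$ ($d\ge0$, $u,v\in\mathbb{Z}$) are defined by $b^0_{0,0}=1$, $b^0_{u,v}=0$ for $(u,v)\ne(0,0)$, and $$b^{d+1}_{u,v}=b^d_{u-1,v}+(u+1)\,b^d_{u+1,v-1}+(v+1)\,b^d_{u-1,v+1}$$ (in particular $b^d_{u,v}=0$ if $u<0$ or $v<0$ or $u+v>d$). For non-negative integers $u,v$ with $u+v=\alpha+\beta$, the integer $\varepsilon(\alpha,\beta;u,v)$ is defined as follows: let $\epsilon_1,\ldots,\epsilon_{\alpha+\beta}$ be given by $\epsilon_i=-1$ for $1\le i\le\alpha$ and $\epsilon_i=1$ for $\alpha+1\le i\le\alpha+\beta$; then $$\varepsilon(\alpha,\beta;u,v)=\sum_{\sigma\in\mathfrak{S}_{u+v}}\epsilon_{\sigma(u+1)}\,\epsilon_{\sigma(u+2)}\cdots\epsilon_{\sigma(u+v)}$$ (empty products are $1$). *)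

(* Defs.v *)
From mathcomp Require Import all_boot all_order all_fingroup all_algebra.

Set Implicit Arguments.
Unset Strict Implicit.
Unset Printing Implicit Defensive.

Import GRing.Theory Num.Theory.
Local Open Scope ring_scope.

(* The sum over all integers k is restricted to the k with a nonzero binomial
   coefficient, i.e. 0 <= k <= alpha + beta. *)
Definition c_coef (d alpha beta : nat) : int :=
  \sum_(k < (alpha + beta).+1)
    'C(alpha + beta, k)%:Z * (beta%:Z - k%:Z) ^+ d * (-1) ^+ k.

Fixpoint b_coef (d : nat) (u v : int) : int :=
  if d is d'.+1 then
    b_coef d' (u - 1) v
    + (u + 1) * b_coef d' (u + 1) (v - 1)
    + (v + 1) * b_coef d' (u - 1) (v + 1)
  else ((u == 0) && (v == 0))%:Z.

(* Positions are numbered from 0: epsilon_(i+1) is [sign_at alpha i]. *)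
Definition sign_at (alpha i : nat) : int := if (i < alpha)%N then -1 else 1.

(* Meaningful when u + v = alpha + beta, so beta is determined by the other
   arguments; the product runs over the last v of the u + v positions. *)
Definition eps (alpha beta u v : nat) : int :=
  \sum_(s : 'S_(u + v)) \prod_(i < u + v | (u <= i)%N) sign_at alpha (s i).

(* Main.v *)
Require Import Defs.
From HB Require Import structures.
From mathcomp Require Import all_boot all_order all_fingroup all_algebra.
From mathcomp Require Import alt primitive_action.
From mathcomp Require Import ring zify.

Import GRing.Theory Num.Theory.
Local Open Scope ring_scope.

(** Both sides are d! times the coefficient of t^d in one exponential series.

    The recurrence for b says that F_d(x, y) = sum_(u,v) b^d_(u,v) x^u y^v
    satisfies F_(d+1) = (x + y d/dx + x d/dy) F_d.  Hence
      sum_d F_d t^d / d! = exp (x sinh t + y (cosh t - 1)),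
    that is, u! v! b^d_(u,v) is d! times the coefficient of t^d in
    (sinh t)^u (cosh t - 1)^v.  This is [b_fact_egf_coef]; its proof is the
    induction on d in which applying d/dt to this product reproduces the
    recurrence, because sinh' = (cosh - 1) + 1 and (cosh - 1)' = sinh.

    On the other side, the sum over the permutations in eps depends only
    on the number v of factors, so eps is u! v! times the v-th elementary
    symmetric sum of the signs ([eps_elem_sym]).  Summing over u + v = n with
    n = alpha + beta therefore expands the product of the n factors
    sinh t + (sign) (cosh t - 1), which is
      (1 - e^(-t))^alpha (e^t - 1)^beta = e^(- alpha t) (e^t - 1)^n
    ([prod_sinh_cosh1]).  The binomial theorem turns the last expression into
    the alternating sum c ([egf_coef_c_coef]).

    To stay within integer polynomials, q stands for e^t, and a Laurent
    polynomial in q of the above kind, homogeneous of degree n in the two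
    series, is multiplied by (2 q)^n. *)

(** * Elementary symmetric sums *)

Definition elem_sym (n : nat) (f : 'I_n -> int) (v : nat) : int :=
  \sum_(B : {set 'I_n} | #|B| == v) \prod_(i in B) f i.

(** The symmetric group is |T|-transitive, hence carries the listing of [A] to
    that of [B]. *)
Lemma perm_imset_of_card (T : finType) (A B : {set T}) :
  #|A| = #|B| -> exists p : {perm T}, p @: A = B.
Proof.
move=> eqAB.
have enum_dtuple (C : {set T}) (szC : size (enum C) == #|B|) :
    Tuple szC \in (#|B|).-dtuple([set: T]).
  by rewrite inE /= enum_uniq; apply/subsetP=> x _; rewrite inE.
have szA : size (enum A) == #|B| by rewrite -cardE eqAB.
have szB : size (enum B) == #|B| by rewrite -cardE.
have trB := ntransitive_weak (max_card (mem B)) (Sym_trans T).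
have [p _ /(congr1 val)/= pAB] :=
  atransP2 trB (enum_dtuple A szA) (enum_dtuple B szB).
exists p; apply/setP=> y; rewrite -[RHS]mem_enum pAB.
apply/imsetP/mapP => -[x Ax ->]; exists x => //; first by rewrite mem_enum.
by rewrite -mem_enum.
Qed.

Lemma sum_perm_prod_card {n : nat} (f : 'I_n -> int) (A B : {set 'I_n}) :
  #|A| = #|B| ->
  \sum_(s : 'S_n) \prod_(i in A) f (s i) =
  \sum_(s : 'S_n) \prod_(i in B) f (s i).
Proof.
move=> /perm_imset_of_card[p <-]; rewrite (reindex_inj (mulgI p)) /=.
apply: eq_bigr => s _; rewrite big_imset /=; last by move=> ? ? _ _ /perm_inj.
by apply: eq_bigr => i _; rewrite permM.
Qed.

Lemma elem_sym_perm (n : nat) (f : 'I_n -> int) (v : nat) (s : 'S_n) :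
  elem_sym n (fun i => f (s i)) v = elem_sym n f v.
Proof.
rewrite [RHS](reindex_inj (imset_inj (@perm_inj _ s))) /=.
apply: eq_big => [B|B _]; first by rewrite card_imset //; apply: perm_inj.
by rewrite big_imset //= => ? ? _ _ /perm_inj.
Qed.

(** Sum the left side over all sets [B] of size [#|A|]: by
    [sum_perm_prod_card] this multiplies it by a binomial coefficient, while
    summing over [B] first gives, for each of the n! permutations, the
    elementary symmetric sum of a rearrangement of [f]. *)
Lemma sum_perm_prod {n : nat} (f : 'I_n -> int) (A : {set 'I_n}) :
  \sum_(s : 'S_n) \prod_(i in A) f (s i) =
  (#|A|`! * (n - #|A|)`!)%:R * elem_sym n f #|A|.
Proof.
set E := LHS; have leA : (#|A| <= n)%N by rewrite -[leqRHS]card_ord max_card.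
have count : 'C(n, #|A|)%:R * E = n`!%:R * elem_sym n f #|A|.
  have <- : \sum_(B : {set 'I_n} | #|B| == #|A|)
              \sum_(s : 'S_n) \prod_(i in B) f (s i) = 'C(n, #|A|)%:R * E.
    rewrite (eq_bigr (fun=> E)) => [|B /eqP]; last exact: sum_perm_prod_card.
    rewrite sumr_const mulr_natl; congr (_ *+ _).
    have := card_draws 'I_n #|A|; rewrite card_ord => <-.
    by apply: eq_card => B; rewrite inE.
  rewrite exchange_big /= (eq_bigr (fun=> elem_sym n f #|A|)) => [|s _].
    by rewrite sumr_const card_Sn mulr_natl.
  exact: elem_sym_perm.
have C0 : 'C(n, #|A|)%:R != 0 :> int by rewrite pnatr_eq0 -lt0n bin_gt0.
by apply: (mulfI C0); rewrite count -(bin_fact leA) natrM mulrA.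
Qed.

Lemma eps_elem_sym (alpha beta u v : nat) :
  eps alpha beta u v =
  (u`! * v`!)%:R * elem_sym (u + v) (fun i => sign_at alpha i) v.
Proof.
pose A : {set 'I_(u + v)} := [set i : 'I_(u + v) | (u <= i)%N].
have cardA : #|A| = v.
  rewrite -sum1dep_card big_mkcond big_split_ord /=.
  rewrite big1 => [|i _]; last by rewrite leqNgt ltn_ord.
  rewrite (eq_bigr (fun=> 1%N)) => [|i _].
    by rewrite sum_nat_const card_ord muln1.
  by rewrite leq_addr.
have := sum_perm_prod (fun i : 'I_(u + v) => sign_at alpha i) A.
rewrite cardA addnK mulnC => <-; apply: eq_bigr => s _.
by apply: eq_bigl => i; rewrite inE.
Qed.

(** The homogeneous form of the generating function of the elementary
    symmetric sums. *)
Lemma prod_add_mul (R : comNzRingType) (n : nat) (f : 'I_n -> int) (x y : R) :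
  \prod_(i < n) (x + (f i)%:~R * y) =
  \sum_(v < n.+1) (elem_sym n f v)%:~R * (x ^+ (n - v) * y ^+ v).
Proof.
under eq_bigr do rewrite addrC.
rewrite bigA_distr.
rewrite (partition_big (fun B : {set 'I_n} => inord #|B| : 'I_n.+1) predT) //=.
apply: eq_bigr => v _; rewrite /elem_sym rmorph_sum mulr_suml /=.
apply: eq_big => [B|B /eqP]; rewrite -?val_eqE /=.
  by rewrite inordK // ltnS -[leqRHS]card_ord max_card.
move=> /(congr1 val)/=; rewrite inordK; last first.
  by rewrite ltnS -[leqRHS]card_ord max_card.
move=> <-; rewrite (bigID (mem B)) /= (eq_bigr (fun i => (f i)%:~R * y)).
  rewrite big_split /= prodr_const [in X in _ * X](eq_bigr (fun=> x)).
    rewrite prodr_const rmorph_prod.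
    have -> : #|[predC B]| = (n - #|B|)%N.
      by apply: (canRL (addKn _)); rewrite cardC card_ord.
    by rewrite -mulrA (mulrC (y ^+ _)).
  by move=> i /negPf ->.
by move=> i ->.
Qed.

(** * Coefficients of exponential sums *)

(** The operator q d/dq = d/dt on p(q) q^(-n), read on the numerator [p]. *)
Definition theta (n : nat) (p : {poly int}) : {poly int} :=
  'X * p^`() - p *+ n.

(** d! times the coefficient of t^d in p(e^t) e^(-nt), obtained as its d-th
    derivative at t = 0, that is at q = 1. *)
Definition egf_coef (d n : nat) (p : {poly int}) : int :=
  (iter d (theta n) p).[1].

Lemma egf_coef_scalar (d n : nat) : scalar (egf_coef d n).
Proof.
move=> a p q; rewrite /egf_coef; elim: d p q => [|d IHd] p q.
  by rewrite /= hornerD hornerZ.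
rewrite !iterSr -IHd; congr (_.[1]); congr iter.
by rewrite /theta derivD derivZ -!mul_polyC; ring.
Qed.

HB.instance Definition _ (d n : nat) :=
  GRing.isLinear.Build int {poly int} int *%R
    (egf_coef d n) (egf_coef_scalar d n).

Lemma egf_coef_theta (d n : nat) (p : {poly int}) :
  egf_coef d.+1 n p = egf_coef d n (theta n p).
Proof. by rewrite /egf_coef iterSr. Qed.

(** The series p(e^t) e^(-nt) and e^t p(e^t) e^(-(n+1)t) agree. *)
Lemma egf_coef_mulX (d n : nat) (p : {poly int}) :
  egf_coef d n.+1 ('X * p) = egf_coef d n p.
Proof.
elim: d p => [|d IHd] p; first by rewrite /egf_coef /= hornerM hornerX mul1r.
rewrite !egf_coef_theta -IHd; congr egf_coef.
by rewrite /theta derivM derivX mulrS; ring.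
Qed.

Lemma egf_coef_Xn (d n k : nat) : egf_coef d n 'X^k = (k%:Z - n%:Z) ^+ d.
Proof.
elim: d => [|d IHd]; first by rewrite /egf_coef /= hornerXn expr1n.
have -> : egf_coef d.+1 n 'X^k = egf_coef d n ((k%:Z - n%:Z) *: 'X^k).
  rewrite egf_coef_theta; congr egf_coef.
  rewrite /theta derivXn -mul_polyC rmorphB /=.
  case: k {IHd} => [|k].
    by rewrite mulr0n -(natz n) -(natz 0) !polyC_natr; ring.
  by rewrite -pred_Sn -(natz n) -(natz k.+1) !polyC_natr exprS; ring.
by rewrite linearZ /= IHd exprS.
Qed.

(** Numerators of 2 sinh t = (q^2 - 1) / q and of
    2 (cosh t - 1) = (q - 1)^2 / q. *)
Definition sinh_poly : {poly int} := 'X^2 - 1.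
Definition cosh1_poly : {poly int} := ('X - 1) ^+ 2.

(** The Leibniz rule: the exponents of the denominators add up in a product. *)
Lemma theta_mul (m n : nat) (p q : {poly int}) :
  theta (m + n) (p * q) = theta m p * q + p * theta n q.
Proof. by rewrite /theta derivM mulrnDr; ring. Qed.

Lemma theta_exp (n : nat) (p : {poly int}) :
  theta n (p ^+ n) = (p ^+ n.-1 * theta 1 p) *+ n.
Proof.
elim: n => [|n IHn]; first by rewrite /theta expr0 derivC mulr0 mulr0n subr0.
rewrite exprS -add1n theta_mul IHn add1n -pred_Sn.
by case: n {IHn} => [|n]; rewrite /= ?expr0 ?exprS; ring.
Qed.

(** sinh' = (cosh - 1) + 1, where the constant 1 has numerator 2 q over the
    denominator 2 q. *)
Lemma theta_sinh : theta 1 sinh_poly = cosh1_poly + 2%:R * 'X.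
Proof.
by rewrite /theta /sinh_poly /cosh1_poly derivB derivXn derivC /=; ring.
Qed.

Lemma theta_cosh1 : theta 1 cosh1_poly = sinh_poly.
Proof.
rewrite /theta /sinh_poly /cosh1_poly deriv_exp derivB derivX derivC /=; ring.
Qed.

(** The numerator of (2 sinh t)^u (2 cosh t - 2)^v over q^(u + v). *)
Definition sinh_cosh1 (u v : nat) : {poly int} :=
  sinh_poly ^+ u * cosh1_poly ^+ v.

(** The three terms mirror those of [b_factS].  In the first one the total
    degree drops by one, which the factor 2 q compensates.  The predecessors
    are harmless at zero, since each term is multiplied by the index that it
    lowers. *)
Lemma theta_sinh_cosh1 (u v : nat) :
  theta (u + v) (sinh_cosh1 u v) =
  ('X * sinh_cosh1 u.-1 v) *+ 2 *+ u +
  sinh_cosh1 u.+1 v.-1 *+ v + sinh_cosh1 u.-1 v.+1 *+ u.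
Proof.
rewrite /sinh_cosh1 theta_mul (theta_exp u) (theta_exp v).
rewrite theta_sinh theta_cosh1 !exprS.
move: (sinh_poly ^+ u) (sinh_poly ^+ u.-1) => Su Su1.
move: (cosh1_poly ^+ v) (cosh1_poly ^+ v.-1) => Cv Cv1.
move: sinh_poly cosh1_poly ('X : {poly int}) => S C X.
ring.
Qed.

(** * The numbers b as coefficients *)

(** A term of the recurrence could only leave the region of negative indices
    by raising an index from -1 to 0, and then its factor u + 1 or v + 1
    vanishes. *)
Lemma b_coef_neg (d : nat) (u v : int) :
  (u < 0) || (v < 0) -> b_coef d u v = 0.
Proof.
elim: d u v => [|d IHd] u v neg /=; first by case: eqP; case: eqP => //; lia.
rewrite IHd; last lia.
have [u1|/eqP u1] := eqVneq (u + 1) 0.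
  by rewrite u1 mul0r IHd ?mulr0 ?addr0 //; lia.
have [v1|/eqP v1] := eqVneq (v + 1) 0.
  by rewrite v1 mul0r IHd ?mulr0 ?addr0 //; lia.
by rewrite !IHd ?mulr0 ?addr0 //; lia.
Qed.

(** With this normalization the coefficients in the recurrence become the
    indices [u] and [v] of the term on the left, so that it closes up on
    natural numbers. *)
Definition b_fact (d u v : nat) : int := (u`! * v`!)%:R * b_coef d u%:Z v%:Z.

Lemma b_factS (d u v : nat) :
  b_fact d.+1 u v =
  b_fact d u.-1 v *+ u + b_fact d u.+1 v.-1 *+ v + b_fact d u.-1 v.+1 *+ u.
Proof.
rewrite /b_fact /= !mulrDr.
have pred (m : nat) : (m.+1%:Z - 1) = m%:Z by lia.
have succ (m : nat) : (m%:Z + 1) = m.+1%:Z by lia.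
rewrite !succ; congr (_ + _ + _).
- case: u => [|u]; first by rewrite b_coef_neg ?mulr0 ?mulr0n.
  by rewrite pred factS !natrM; ring.
- case: v => [|v].
    by rewrite [b_coef _ _ _]b_coef_neg ?mulr0 ?mulr0n ?orbT.
  by rewrite pred !factS !natrM; ring.
case: u => [|u]; first by rewrite b_coef_neg ?mulr0 ?mulr0n.
by rewrite pred !factS !natrM; ring.
Qed.

(** The normalized numbers b are the coefficients of
    (sinh t)^u (cosh t - 1)^v; the power of 2 clears the denominators. *)
Lemma b_fact_egf_coef (d u v : nat) :
  2 ^+ (u + v) * b_fact d u v = egf_coef d (u + v) (sinh_cosh1 u v).
Proof.
elim: d u v => [|d IHd] u v.
  have S1 : sinh_poly.[1] = 0 by rewrite /sinh_poly !hornerE subrr.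
  have C1 : cosh1_poly.[1] = 0 by rewrite /cosh1_poly horner_exp !hornerE subrr.
  rewrite /b_fact /egf_coef /sinh_cosh1 /= hornerM.
  rewrite (horner_exp sinh_poly) (horner_exp cosh1_poly) S1 C1 !expr0n.
  by case: u => [|u]; case: v => [|v]; rewrite /= ?mulr1 ?mul0r ?mulr0.
rewrite egf_coef_theta theta_sinh_cosh1 b_factS !linearD !linearMn /= !mulrDr.
congr (_ + _ + _).
- case: u => [|u]; rewrite ?mulr0n ?mulr0 //= addSn.
  rewrite egf_coef_mulX -IHd exprS; ring.
- case: v => [|v]; rewrite ?mulr0n ?mulr0 //= addnS -addSn -IHd; ring.
- case: u => [|u]; rewrite ?mulr0n ?mulr0 //= addSn -addnS -IHd; ring.
Qed.

Lemma b_coef_eps (d alpha beta u v n : nat) :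
  (u + v)%N = n ->
  2 ^+ n * (b_coef d u%:Z v%:Z * eps alpha beta u v) =
  elem_sym n (fun i => sign_at alpha i) v * egf_coef d n (sinh_cosh1 u v).
Proof. by move=> <-; rewrite -b_fact_egf_coef eps_elem_sym /b_fact; ring. Qed.

(** sinh t - (cosh t - 1) = (q - 1) / q and sinh t + (cosh t - 1) = q - 1; both
    are multiplied by 2 q here. *)
Lemma prod_sinh_cosh1 (alpha beta : nat) :
  \prod_(i < alpha + beta) (sinh_poly + (sign_at alpha i)%:~R * cosh1_poly) =
  2 ^+ (alpha + beta) * ('X^beta * ('X - 1) ^+ (alpha + beta)).
Proof.
rewrite big_split_ord /=.
rewrite (eq_bigr (fun=> 2 * ('X - 1))) => [|i _]; last first.
  by rewrite /sign_at ltn_ord /sinh_poly /cosh1_poly; ring.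
rewrite [X in _ * X](eq_bigr (fun=> 2 * ('X * ('X - 1)))) => [|i _]; last first.
  rewrite /sign_at ltnNge leq_addr /sinh_poly /cosh1_poly /=; ring.
by rewrite !prodr_const !card_ord !exprMn !exprD; ring.
Qed.

Lemma egf_coef_c_coef (d alpha beta : nat) :
  egf_coef d (alpha + beta) ('X^beta * ('X - 1) ^+ (alpha + beta)) =
  c_coef d alpha beta.
Proof.
rewrite exprBn mulr_sumr linear_sum /c_coef; apply: eq_bigr => k _ /=.
have le_k : (k <= alpha + beta)%N by rewrite -ltnS.
rewrite expr1n mulr1 mulrnAr linearMn /= mulrCA -exprD.
have -> : (-1) ^+ k * 'X^(beta + (alpha + beta - k)) =
    (-1) ^+ k *: 'X^(beta + (alpha + beta - k)) :> {poly int}.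
  by rewrite -mul_polyC rmorphXn rmorphN1.
rewrite linearZ /= egf_coef_Xn -mulr_natl natz.
have -> : (beta + (alpha + beta - k))%N%:Z - (alpha + beta)%N%:Z =
          beta%:Z - k%:Z by lia.
ring.
Qed.

Theorem lemmaA6 (d alpha beta : nat) :
  c_coef d alpha beta =
  \sum_(u < (alpha + beta).+1)
    \sum_(v < (alpha + beta).+1 | (u + v)%N == (alpha + beta)%N)
      b_coef d u%:Z v%:Z * eps alpha beta u v.
Proof.
set n := (alpha + beta)%N.
have two0 : 2 ^+ n != 0 :> int by rewrite expf_neq0.
apply: (mulfI two0); rewrite (exchange_big_dep predT) //= [RHS]mulr_sumr.
pose e v := elem_sym n (fun i => sign_at alpha i) v.
have diag (v : 'I_n.+1) :
    2 ^+ n * (\sum_(u < n.+1 | (u + v)%N == n)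
                 b_coef d u%:Z v%:Z * eps alpha beta u v) =
    egf_coef d n ((e v)%:~R * sinh_cosh1 (n - v) v).
  have le_v : (v <= n)%N by rewrite -ltnS.
  rewrite (big_pred1 (rev_ord v)) => [|u]; last first.
    by rewrite /= -val_eqE /= subSS; apply/eqP/eqP; lia.
  rewrite /= subSS b_coef_eps ?subnK // mulrzl raddfMz /=.
  by rewrite -mulrzl intz.
under [RHS]eq_bigr do rewrite diag.
rewrite -linear_sum -prod_add_mul /=.
rewrite prod_sinh_cosh1 -/n.
have -> : 2 ^+ n * ('X^beta * ('X - 1) ^+ n) =
    2 ^+ n *: ('X^beta * ('X - 1) ^+ n) :> {poly int}.
  by rewrite -mul_polyC rmorphXn rmorph_nat.
by rewrite linearZ /= egf_coef_c_coef.
Qed.
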